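(* Let $(Z_i^{(1)})_{i\ge1}$ and $(Z_i^{(2)})_{i\ge1}$ be two mutually independent sequences, each consisting of independent and identically distributed random vectors in $\mathbb{R}^2$ (the two laws may differ), with $\mathbb{E}\|Z_1^{(k)}\|<\infty$ and $\boldsymbol{\mu}^{(k)}=\mathbb{E}[Z_1^{(k)}]$ for $k=1,2$. Let $S_0^{(k)}=0$ and $S_n^{(k)}=\sum_{i=1}^n Z_i^{(k)}$. Then, in the metric space of convex and compact subsets of $\mathbb{R}^2$ endowed with the Hausdorff metric, $$n^{-1}\,\mathrm{chull}\{S_j^{(k)}:0\le j\le n,\ k=1,2\}\longrightarrow \mathrm{chull}\{\boldsymbol{0},\boldsymbol{\mu}^{(1)},\boldsymbol{\mu}^{(2)}\}\quad\text{almost surely as } n\to\infty.$$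
   Context: $\|\cdot\|$ is the Euclidean norm and $\mathrm{chull}(A)$ is the convex hull of $A$. The Hausdorff distance of closed bounded sets $A,B$ is $\max\{\sup_{x\in A}\rho(x,B),\sup_{y\in B}\rho(y,A)\}$, where $\rho(x,A)=\inf_{y\in A}\|x-y\|$. *)

(* Defs.v *)
From HB Require Import structures.
From mathcomp Require Import all_boot all_order all_algebra finmap.
From mathcomp Require Import all_classical all_reals all_analysis.
From mathcomp Require Import ring lra.

Set Implicit Arguments.
Unset Strict Implicit.
Unset Printing Implicit Defensive.

Import Order.TTheory GRing.Theory Num.Theory.
Import numFieldNormedType.Exports.

Local Open Scope classical_set_scope.
Local Open Scope ring_scope.

(* The norm that the library puts on row vectors is the sup norm. It has the
   same topology as the Euclidean norm, hence the same compact sets and the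
   same Borel sets. *)
Definition enorm (R : realType) (d : nat) (x : 'rV[R]_d) : R :=
  Num.sqrt (\sum_i x ord0 i ^+ 2).

Section euclidean_norm.
Context {R : realType} {d : nat}.
Implicit Types x y : 'rV[R]_d.

Let sumsq_ge0 x : 0 <= \sum_i x ord0 i ^+ 2.
Proof. by apply: sumr_ge0 => i _; exact: sqr_ge0. Qed.

Lemma enorm_ge0 x : 0 <= enorm x.
Proof. exact: sqrtr_ge0. Qed.

Lemma enorm0 : enorm (0 : 'rV[R]_d) = 0.
Proof. by rewrite /enorm big1 ?sqrtr0// => i _; rewrite mxE expr0n. Qed.

Lemma enormN x : enorm (- x) = enorm x.
Proof. by congr Num.sqrt; apply: eq_bigr => i _; rewrite mxE sqrrN. Qed.

Lemma enorm_distC x y : enorm (x - y) = enorm (y - x).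
Proof. by rewrite -enormN opprB. Qed.

Lemma enorm_coord x i : `|x ord0 i| <= enorm x.
Proof.
rewrite -sqrtr_sqr ler_wsqrtr// (bigD1 i)//= lerDl.
by apply: sumr_ge0 => j _; exact: sqr_ge0.
Qed.

Lemma normr_le_enorm x : `|x| <= enorm x.
Proof.
rewrite /Num.norm/= mx_normrE; apply/bigmax_leP; split; first exact: enorm_ge0.
by move=> [i j] _ /=; rewrite (ord1 i); exact: enorm_coord.
Qed.

Lemma enorm_le_normr x : enorm x <= Num.sqrt d%:R * `|x|.
Proof.
rewrite -[X in _ * X]ger0_norm// -sqrtr_sqr -sqrtrM ?ler0n//.
rewrite ler_wsqrtr// mulr_natl -[X in _ *+ X]card_ord -sumr_const.
apply: ler_sum => i _; rewrite -[leLHS]real_normK ?num_real//.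
rewrite ler_sqr ?nnegrE// [leRHS]/Num.norm/= mx_normrE.
by apply/bigmax_geP; right; exists (ord0, i).
Qed.

Let cauchy_schwarz x y :
  \sum_i x ord0 i * y ord0 i <= enorm x * enorm y.
Proof.
have [x0|x0] := eqVneq (enorm x) 0.
  rewrite x0 mul0r big1// => i _.
  have := enorm_coord x i; rewrite x0 normr_le0 => /eqP ->.
  by rewrite mul0r.
have [y0|y0] := eqVneq (enorm y) 0.
  rewrite y0 mulr0 big1// => i _.
  have := enorm_coord y i; rewrite y0 normr_le0 => /eqP ->.
  by rewrite mulr0.
have a0 : 0 < enorm x by rewrite lt_def x0 enorm_ge0.
have b0 : 0 < enorm y by rewrite lt_def y0 enorm_ge0.
have xE : \sum_i x ord0 i ^+ 2 = enorm x ^+ 2 by rewrite sqr_sqrtr.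
have yE : \sum_i y ord0 i ^+ 2 = enorm y ^+ 2 by rewrite sqr_sqrtr.
move: xE yE a0 b0; set a := enorm x; set b := enorm y => xE yE a0 b0.
have : 0 <= \sum_i (b * x ord0 i - a * y ord0 i) ^+ 2.
  by apply: sumr_ge0 => i _; exact: sqr_ge0.
have -> : \sum_i (b * x ord0 i - a * y ord0 i) ^+ 2 =
    b ^+ 2 * (\sum_i x ord0 i ^+ 2) + a ^+ 2 * (\sum_i y ord0 i ^+ 2)
    - (2 * a * b) * \sum_i x ord0 i * y ord0 i.
  rewrite !mulr_sumr -!big_split/= -sumrB; apply: eq_bigr => i _; ring.
rewrite xE yE => h.
have ab : 0 < 2 * a * b by rewrite !mulr_gt0.
rewrite -(ler_pM2l ab); lra.
Qed.

Lemma ler_enormD x y : enorm (x + y) <= enorm x + enorm y.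
Proof.
rewrite -(@ler_pXn2r _ 2)// ?nnegrE ?addr_ge0 ?enorm_ge0//.
rewrite {1}/enorm sqr_sqrtr//.
have -> : \sum_i (x + y) ord0 i ^+ 2 = \sum_i x ord0 i ^+ 2
    + \sum_i y ord0 i ^+ 2 + 2 * \sum_i x ord0 i * y ord0 i.
  rewrite mulr_sumr -!big_split/=; apply: eq_bigr => i _; rewrite mxE; ring.
have -> : \sum_i x ord0 i ^+ 2 = enorm x ^+ 2 by rewrite sqr_sqrtr.
have -> : \sum_i y ord0 i ^+ 2 = enorm y ^+ 2 by rewrite sqr_sqrtr.
have := cauchy_schwarz x y; lra.
Qed.

Lemma ler_edistD y x z : enorm (x - z) <= enorm (x - y) + enorm (y - z).
Proof. by rewrite (le_trans _ (ler_enormD _ _))// addrA subrK. Qed.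

End euclidean_norm.

Definition rho (R : realType) (d : nat) (x : 'rV[R]_d) (A : set 'rV[R]_d) : R :=
  inf [set enorm (x - y) | y in A].

Definition hausdorff_dist (R : realType) (d : nat) (A B : set 'rV[R]_d) : R :=
  Num.max (sup [set rho x B | x in A]) (sup [set rho y A | y in B]).

(* The real-valued suprema and infima above are meaningful for nonempty
   bounded sets only, and the Hausdorff distance is a metric on the nonempty
   sets: compact sets are therefore required to be nonempty here. *)
Record convex_body (R : realType) (d : nat) := ConvexBody {
  body_set :> set 'rV[R]_d ;
  body_neq0 : body_set !=set0 ;
  body_compact : compact body_set ;
  body_convex : convex_set body_set }.

Section hausdorff_metric.
Context {R : realType} {d : nat}.
Implicit Types (A B C : convex_body R d) (x y : 'rV[R]_d).

Lemma convex_body_eq A B : A = B :> set _ -> A = B.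
Proof.
case: A B => [A A0 cA vA] [B B0 cB vB] /= AB; subst B.
by congr ConvexBody; exact: Prop_irrelevance.
Qed.

Let body_bounded A : exists M, forall x, body_set A x -> enorm x <= M.
Proof.
have [M [_ AM]] := compact_bounded (@body_compact _ _ A).
exists (Num.sqrt d%:R * (M + 1)) => x Ax.
rewrite (le_trans (enorm_le_normr x))// ler_wpM2l ?sqrtr_ge0//.
by apply: AM => //; rewrite ltrDl.
Qed.

Let dists_neq0 x B : [set enorm (x - y) | y in B] !=set0.
Proof. by have [y By] := body_neq0 B; exists (enorm (x - y)), y. Qed.

Lemma rho_le x y B : body_set B y -> rho x B <= enorm (x - y).
Proof.
move=> By; apply: inf_lbound; last by exists y.
by exists 0 => _ [z _ <-]; exact: enorm_ge0.
Qed.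

Lemma rho_ge x B r :
  (forall y, body_set B y -> r <= enorm (x - y)) -> r <= rho x B.
Proof.
by move=> h; apply: lb_le_inf; [exact: dists_neq0|move=> _ [y By <-]; exact: h].
Qed.

Lemma rho_ge0 x B : 0 <= rho x B.
Proof. by apply: rho_ge => y _; exact: enorm_ge0. Qed.

Let rhos_bounded A B : has_ubound [set rho x B | x in A].
Proof.
have [M AM] := body_bounded A; have [N BN] := body_bounded B.
have [y By] := body_neq0 B.
exists (M + N) => _ [x Ax <-]; rewrite (le_trans (rho_le x By))//.
by rewrite (le_trans (ler_enormD _ _))// enormN lerD// ?AM ?BN.
Qed.

Lemma rho_hausdorff_l x A B : body_set A x -> rho x B <= hausdorff_dist A B.
Proof.
move=> Ax; rewrite le_max ub_le_sup//.
by exists x.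
Qed.

Lemma hausdorff_distC A B : hausdorff_dist A B = hausdorff_dist B A.
Proof. by rewrite /hausdorff_dist maxC. Qed.

Lemma hausdorff_dist_le A B r : (forall x, body_set A x -> rho x B <= r) ->
  (forall y, body_set B y -> rho y A <= r) -> hausdorff_dist A B <= r.
Proof.
move=> AB BA; rewrite ge_max; apply/andP; split; apply: ge_sup.
- by have [x Ax] := body_neq0 A; exists (rho x B), x.
- by move=> _ [x Ax <-]; exact: AB.
- by have [x Bx] := body_neq0 B; exists (rho x A), x.
- by move=> _ [x Bx <-]; exact: BA.
Qed.

Lemma hausdorff_dist_ge0 A B : 0 <= hausdorff_dist A B.
Proof.
have [x Ax] := body_neq0 A.
by rewrite (le_trans _ (rho_hausdorff_l B Ax))// rho_ge0.
Qed.

Lemma hausdorff_distxx A : hausdorff_dist A A = 0.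
Proof.
apply/eqP; rewrite eq_le hausdorff_dist_ge0 andbT.
apply: hausdorff_dist_le => x Ax.
  by rewrite (le_trans (rho_le x Ax))// subrr enorm0.
by rewrite (le_trans (rho_le x Ax))// subrr enorm0.
Qed.

Lemma rho0_mem x B : rho x B <= 0 -> body_set B x.
Proof.
move=> h.
have Bcl : closed (body_set B : set 'rV[R]_d).
  apply: compact_closed; first exact: norm_hausdorff.
  exact: (@body_compact _ _ B).
apply: Bcl => V /nbhs_ballP[e /= e0 eV].
have /(inf_lt (dists_neq0 x B))[_ [y By <-] xy] : rho x B < e.
  by rewrite (le_lt_trans h).
exists y; split => //; apply: eV.
by rewrite -ball_normE/= (le_lt_trans (normr_le_enorm _)).
Qed.

Lemma hausdorff_dist_eq0 A B : hausdorff_dist A B = 0 -> A = B.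
Proof.
move=> AB0; apply: convex_body_eq; apply/seteqP; split => x Hx; apply: rho0_mem.
- by rewrite -AB0 rho_hausdorff_l.
- by rewrite -AB0 hausdorff_distC rho_hausdorff_l.
Qed.

Let rho_triangle x B C : rho x C <= rho x B + hausdorff_dist B C.
Proof.
rewrite -lerBlDr; apply: rho_ge => y By; rewrite lerBlDr.
have : rho x C <= enorm (x - y) + rho y C.
  rewrite -lerBlDl; apply: rho_ge => z Cz; rewrite lerBlDl.
  exact: le_trans (rho_le x Cz) (ler_edistD _ _ _).
by move=> /le_trans; apply; rewrite lerD2l rho_hausdorff_l.
Qed.

Lemma hausdorff_dist_triangle B A C :
  hausdorff_dist A C <= hausdorff_dist A B + hausdorff_dist B C.
Proof.
apply: hausdorff_dist_le => x Hx.
  by rewrite (le_trans (rho_triangle x B C))// lerD2r rho_hausdorff_l.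
rewrite (le_trans (rho_triangle x B A))// [leRHS]addrC.
by rewrite (hausdorff_distC A) lerD2r (hausdorff_distC B C) rho_hausdorff_l.
Qed.

HB.instance Definition _ := gen_eqMixin (convex_body R d).
HB.instance Definition _ := gen_choiceMixin (convex_body R d).
HB.instance Definition _ := isMetric.Build R (convex_body R d)
  hausdorff_distxx hausdorff_dist_eq0 hausdorff_distC hausdorff_dist_triangle.

Lemma mdist_convex_bodyE A B : mdist A B = hausdorff_dist A B.
Proof. by []. Qed.

End hausdorff_metric.

Definition chull (R : realType) (d : nat) (A : set 'rV[R]_d) : set 'rV[R]_d :=
  smallest (@convex_set R 'rV[R]_d) A.

Section convex_hull.
Context {R : realType} {d : nat}.
Implicit Types A : set 'rV[R]_d.

Lemma chull_convex A : convex_set (chull A : set (convex_lmodType _)).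
Proof.
move=> x y l /set_mem xA /set_mem yA; apply/mem_set => B BA.
by apply/set_mem/BA.1; apply/mem_set; [exact: xA|exact: yA].
Qed.

Lemma sub_chull A : A `<=` chull A.
Proof. exact: sub_gen_smallest. Qed.

Lemma convex_setP A : convex_set (A : set (convex_lmodType _)) <->
  forall x y (t : R), 0 <= t -> t <= 1 -> A x -> A y ->
    A (t *: x + (1 - t) *: y).
Proof.
split=> [cA x y t t0 t1 Ax Ay|cA x y l /set_mem Ax /set_mem Ay].
  exact/set_mem/(cA x y (Itv01 t0 t1) (mem_set Ax) (mem_set Ay)).
by apply/mem_set; exact: cA.
Qed.

Let simplex (m : nat) : set 'rV[R]_m :=
  [set a | (forall i, 0 <= a ord0 i) /\ \sum_i a ord0 i = 1].

Let sum_coord_continuous m :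
  continuous (fun a : 'rV[R]_m => \sum_i a ord0 i).
Proof.
apply: continuous_big => [|i _]; first exact: add_continuous.
exact: coord_continuous.
Qed.

Let simplex_compact m : compact (@simplex m).
Proof.
apply: bounded_closed_compact.
  exists 1; split; first exact: num_real.
  move=> M M1 a [a0 a1] /=; rewrite (le_trans _ (ltW M1))//.
  rewrite /Num.norm/= mx_normrE; apply/bigmax_leP; split => // -[i j] _ /=.
  rewrite (ord1 i) ger0_norm// -a1 (bigD1 j)//= lerDl.
  by apply: sumr_ge0 => k _; exact: a0.
have -> : @simplex m =
    (\bigcap_i (fun a : 'rV[R]_m => a ord0 i) @^-1` [set x | 0 <= x])
    `&` (fun a : 'rV[R]_m => \sum_i a ord0 i) @^-1` [set 1].
  apply/seteqP; split => a [h ?]; split => // i; first by move=> _; exact: h.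
  exact: h.
apply: closedI.
  apply: closed_bigI => i _; apply: preimage_closed; last exact: closed_ge.
  by move=> a _; exact: coord_continuous.
apply: preimage_closed; last exact: closed_eq.
by move=> a _; exact: sum_coord_continuous.
Qed.

Let convex_sum A (I : eqType) (r : seq I) (F : I -> 'rV[R]_d) (a : I -> R) :
  convex_set (A : set (convex_lmodType _)) ->
  (forall i, A (F i)) -> (forall i, 0 <= a i) -> 0 < \sum_(i <- r) a i ->
  A ((\sum_(i <- r) a i)^-1 *: \sum_(i <- r) a i *: F i).
Proof.
move=> /convex_setP cA AF a0; elim: r => [|i r IH].
  by rewrite big_nil ltxx.
rewrite !big_cons; set s := \sum_(j <- r) a j; set v := \sum_(j <- r) _.
have s0 : 0 <= s by apply: sumr_ge0.
move=> as0; have [sE|sN0] := eqVneq s 0.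
  have -> : v = 0.
    have := sE; rewrite /s => /eqP; rewrite psumr_eq0// => /allP h.
    by rewrite /v big_seq big1// => j /h/= /eqP ->; rewrite scale0r.
  have aN0 : a i != 0 by move: as0; rewrite sE addr0 => /gt_eqF ->.
  by rewrite sE !addr0 scalerA mulVf// scale1r.
have sp : 0 < s by rewrite lt_def sN0.
have asN0 : a i + s != 0 by rewrite gt_eqF.
have := cA (F i) (s^-1 *: v) (a i / (a i + s)) _ _ (AF i) (IH sp).
have -> : 1 - a i / (a i + s) = s / (a i + s) by field.
rewrite scalerA.
have -> : s / (a i + s) / s = (a i + s)^-1 by rewrite mulrAC divff// mul1r.
rewrite scalerDr scalerA [_^-1 * _]mulrC; apply.
  by rewrite divr_ge0// addr_ge0.
by rewrite ler_pdivrMr// mul1r lerDl.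
Qed.

Lemma chull_seqE (s : seq 'rV[R]_d) : chull [set` s] =
  [set \sum_i a ord0 i *: s`_i | a in
     [set a : 'rV[R]_(size s) |
       (forall i, 0 <= a ord0 i) /\ \sum_i a ord0 i = 1]].
Proof.
apply/seteqP; split.
  apply: smallest_sub.
    apply/convex_setP => _ _ t t0 t1 [a [a0 a1] <-] [b [b0 b1] <-].
    exists (t *: a + (1 - t) *: b).
      split=> [i|]; first by rewrite !mxE addr_ge0// mulr_ge0// subr_ge0.
      under eq_bigr do rewrite !mxE.
      by rewrite big_split/= -!mulr_sumr a1 b1 !mulr1 addrC subrK.
    rewrite !scaler_sumr -big_split/=; apply: eq_bigr => i _.
    by rewrite !mxE !scalerA -scalerDl.
  move=> x /= xs; have xsz : (index x s < size s)%N by rewrite index_mem.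
  exists (delta_mx ord0 (Ordinal xsz)).
    split=> [i|]; first by rewrite mxE ler0n.
    rewrite (bigD1 (Ordinal xsz))//= mxE !eqxx big1 ?addr0// => j /negPf jx.
    by rewrite mxE jx andbF.
  rewrite (bigD1 (Ordinal xsz))//= mxE !eqxx scale1r big1 ?addr0 ?nth_index//.
  by move=> j /negPf jx; rewrite mxE jx andbF scale0r.
move=> _ [a [a0 a1] <-] A [cA sA].
have := @convex_sum A _ (index_enum 'I_(size s)) (fun i => s`_i) (a ord0) cA.
rewrite a1 invr1 scale1r; apply => // i.
by apply: sA => /=; exact: mem_nth.
Qed.

Lemma chull_compact A : finite_set A -> compact (chull A).
Proof.
move=> /finite_seqP[s ->]; rewrite chull_seqE.
apply: continuous_compact; last exact: simplex_compact.
apply: continuous_subspaceT; apply: continuous_big => [|i _].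
  exact: add_continuous.
move=> a.
apply: (@cvgZr_tmp _ _ _ (nbhs a) _ (fun b : 'rV[R]_(size s) => b ord0 i)).
exact: coord_continuous.
Qed.

End convex_hull.

Section convex_body_constructions.
Context {R : realType} {d : nat}.

Definition chull_body (A : set 'rV[R]_d) (finA : finite_set A) (A0 : A !=set0) :
    convex_body R d :=
  ConvexBody (subset_nonempty (@sub_chull R d A) A0) (chull_compact finA)
    (@chull_convex R d A).

Variables (c : R) (K : convex_body R d).

Let scale_neq0 : [set c *: x | x in body_set K] !=set0.
Proof. by have [x Kx] := body_neq0 K; exists (c *: x), x. Qed.

Let scale_compact : compact ([set c *: x | x in body_set K] : set 'rV[R]_d).
Proof.
apply: continuous_compact; last exact: (@body_compact _ _ K).
by apply: continuous_subspaceT => x; exact: scaler_continuous.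
Qed.

Let scale_convex :
  convex_set ([set c *: x | x in body_set K] : set (convex_lmodType 'rV[R]_d)).
Proof.
apply/convex_setP => _ _ t t0 t1 [x Kx <-] [y Ky <-].
exists (t *: x + (1 - t) *: y).
  by have /convex_setP := @body_convex _ _ K; exact.
by rewrite scalerDr !scalerA ![c * _]mulrC.
Qed.

Definition scale_body : convex_body R d :=
  ConvexBody scale_neq0 scale_compact scale_convex.

End convex_body_constructions.

Arguments chull_body {R d} A finA A0.

Definition borel_rV (R : realType) (d : nat) :=
  g_sigma_algebraType (@open 'rV[R]_d).

HB.instance Definition _ (R : realType) (d : nat) :=
  Measurable.on (borel_rV R d).

Section random_vectors.
Context {R : realType} {m : nat} {d : measure_display} {T : measurableType d}.
Variable P : probability T R.
Implicit Types X Y : {RV P >-> borel_rV R m}.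

Definition mean_vector (X : T -> 'rV[R]_m) : 'rV[R]_m :=
  \row_i fine 'E_P[fun w => X w ord0 i].

(* [distribution P X] is the total function [B |-> P (X @^-1` B)], whose values
   outside of the Borel sets carry no information. *)
Definition same_law X Y : Prop := forall B : set (borel_rV R m),
  measurable B -> distribution P X B = distribution P Y B.

Definition mutually_independent (I : choiceType)
    (X : I -> {RV P >-> borel_rV R m}) : Prop :=
  forall (J : {fset I}) (B : I -> set (borel_rV R m)),
    (forall i, measurable (B i)) ->
    P (\bigcap_(i in [set` J]) X i @^-1` B i) =
      (\prod_(i <- J) P (X i @^-1` B i))%E.

Definition iid (X : nat -> {RV P >-> borel_rV R m}) : Prop :=
  mutually_independent X /\ forall i, same_law (X i) (X 0%N).

Definition sigma_of_sequence (X : nat -> {RV P >-> borel_rV R m}) :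
    set (set T) :=
  <<s \bigcup_i preimage_set_system [set: T] (X i) measurable >>.

Definition independent_sequences (X Y : nat -> {RV P >-> borel_rV R m}) :
    Prop :=
  forall A B, sigma_of_sequence X A -> sigma_of_sequence Y B ->
    P (A `&` B) = (P A * P B)%E.

End random_vectors.

Section walks.
Context {R : realType} {m : nat} {T : Type}.

(* Indices are shifted by one: [X i] is the increment of the step from time
   [i] to time [i.+1], so that [walk X n] is the sum of the first [n]
   increments. *)
Definition walk (X : nat -> T -> 'rV[R]_m) (n : nat) (w : T) : 'rV[R]_m :=
  \sum_(i < n) X i w.

Definition walk_points (X : 'I_2 -> nat -> T -> 'rV[R]_m) (n : nat) (w : T) :
    set 'rV[R]_m :=
  [set x | exists j k, (j <= n)%N /\ x = walk (X k) j w].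

Lemma walk_points_finite X n w : finite_set (walk_points X n w).
Proof.
have -> : walk_points X n w =
    [set walk (X jk.2) jk.1 w | jk in [set: 'I_n.+1 * 'I_2]].
  apply/seteqP; split => [x [j [k [jn ->]]]|_ [[j k] _ <-]].
    by exists (Ordinal (jn : (j < n.+1)%N), k).
  by exists j, k; split => //; rewrite -ltnS.
by apply: finite_image; exact: finite_finset.
Qed.

Lemma walk_points_neq0 X n w : walk_points X n w !=set0.
Proof. by exists (walk (X ord0) 0 w), 0%N, ord0. Qed.

End walks.

Lemma set3_finite (T : Type) (x y z : T) : finite_set [set x; y; z].
Proof. by rewrite !finite_setU; do ![split => //]; exact: finite_set1. Qed.

Lemma set3_neq0 (T : Type) (x y z : T) : [set x; y; z] !=set0.
Proof. by exists x; left; left. Qed.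

(* Main.v *)
(* By the strong law of large numbers S_n^(k) / n -> mu^(k) almost surely for
   both k, and the rest is deterministic. Uniformly in j <= n, the point S_j / n
   is close to (j / n) mu, which lies in chull {0, mu^(1), mu^(2)}; conversely 0
   and the mu^(k) are close to the points S_0 / n and S_n^(k) / n. Since the
   points at distance at most e from a convex set form a convex set, both
   estimates pass to the hulls.

   The strong law is first proved for nonnegative, pairwise independent,
   identically distributed X_i, in the spirit of Etemadi. Clip all the X_i with
   i < k at the level k: a union bound and Chebyshev's inequality bound the
   probability that S_k / k is e-far from E[min (X_0, k)] by a constant times
   E[min (X_0, k)^2 / k]. Along k = c 2^a these bounds are summable in a, because
   sum_a min (x, c 2^a)^2 / (c 2^a) <= 3 x, so that Borel-Cantelli gives
   convergence along each of these subsequences. Monotonicity of S_n, with c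
   ranging over [m, 2 m) for a large m, interpolates between them. *)
From HB Require Import structures.
Require Import Defs.
From mathcomp Require Import all_boot all_order all_algebra finmap.
From mathcomp Require Import all_classical all_reals all_analysis.
From mathcomp Require Import measurable_realfun.
From mathcomp Require Import ring lra.

Set Implicit Arguments.
Unset Strict Implicit.
Unset Printing Implicit Defensive.

Import Order.TTheory GRing.Theory Num.Theory.
Import numFieldNormedType.Exports.

Local Open Scope classical_set_scope.
Local Open Scope ring_scope.

(** * Two deterministic estimates *)

(** Both ranges of [a] are geometric: as long as [k * 2 ^+ a <= x] the terms are [k * 2 ^+ a], and
    afterwards they are [x ^+ 2 / (k * 2 ^+ a)]. *)
Lemma sum_clip_sqr_le (R : realFieldType) (k x : R) (n : nat) :
  0 < k -> 0 <= x ->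
  \sum_(a < n) Num.min x (k * 2 ^+ a) ^+ 2 / (k * 2 ^+ a) <= 3 * x.
Proof.
move=> k0 x0; pose K n := k * 2 ^+ n.
pose u m := \sum_(a < m) Num.min x (K a) ^+ 2 / K a; rewrite -/(u n).
have K0 m : 0 < K m by rewrite mulr_gt0// exprn_gt0.
have KS m : K m.+1 = 2 * K m by rewrite /K exprS; ring.
(* The subtracted [2 * x ^+ 2 / K m] is the full tail of [x ^+ 2 / K a] over [a >= m], so the second
   bound reproduces itself under induction. *)
suff h m : (K m <= x -> u m <= K m) /\
           (x <= K m -> u m <= 3 * x - 2 * x ^+ 2 / K m).
  have [hK|/ltW hK] := leP (K n) x; first by have := (h n).1 hK; lra.
  have := (h n).2 hK; have : 0 <= 2 * x ^+ 2 / K n.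
    by rewrite divr_ge0 ?mulr_ge0 ?sqr_ge0// ltW.
  lra.
elim: m => [|m [IH1 IH2]].
  have -> : u 0%N = 0 by rewrite /u big_ord0.
  have K00 : K 0%N = k by rewrite /K expr0 mulr1.
  split; first by move=> _; exact/ltW.
  rewrite K00 => xk; rewrite subr_ge0 ler_pdivrMr//; nra.
have uS : u m.+1 = u m + Num.min x (K m) ^+ 2 / K m by rewrite /u big_ord_recr.
rewrite KS uS; have K0m := K0 m; set q := K m in IH1 IH2 K0m *.
have qE : q ^+ 2 / q = q by field; rewrite gt_eqF.
split=> [qx|xq].
  have {}qx' : q <= x by lra.
  rewrite min_r// qE; have := IH1 qx'; lra.
have [qx|/ltW qx] := leP q x.
  rewrite qE; have := IH1 qx => uq.
  suff : 2 * x ^+ 2 / (2 * q) <= 3 * x - 2 * q by lra.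
  rewrite ler_pdivrMr; last lra.
  (* At the crossing [q <= x <= 2 * q] the claim amounts to [(x - q) * (2 * q - x) >= 0]. *)
  have := mulr_ge0 (_ : 0 <= x - q) (_ : 0 <= 2 * q - x).
  have h1 : 0 <= x - q by lra.
  have h2 : 0 <= 2 * q - x by lra.
  move=> /(_ h1 h2); nra.
have := IH2 qx; have -> : 2 * x ^+ 2 / (2 * q) = x ^+ 2 / q.
  by field; rewrite gt_eqF.
have -> : 2 * x ^+ 2 / q = 2 * (x ^+ 2 / q) by rewrite mulrA.
lra.
Qed.

Lemma cvg_dyadic_average (R : realType) (S : nat -> R) (mu : R) :
  nondecreasing_seq S -> 0 <= mu ->
  (forall c, (0 < c)%N ->
    S (c * 2 ^ a)%N / (c * 2 ^ a)%:R @[a --> \oo] --> mu) ->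
  S n / n%:R @[n --> \oo] --> mu.
Proof.
move=> ndS mu0 Sc; apply/cvgrPdist_le => /= e e0.
have e20 : 0 < e / 2 by lra.
(* Writing [n] as [c * 2 ^ a <= n < c.+1 * 2 ^ a] with [m <= c < 2 * m] squeezes
   [S n] between dyadic terms whose indices differ by a factor at most
   [1 + 1 / m]; only finitely many [c] occur. *)
pose m := (Num.truncn (2 * (mu + e) / e)).+1.
have hm : 2 * (mu + e) / e <= m%:R by apply/ltW; exact: truncnS_gt.
have m0 : 0 < m%:R :> R by rewrite ltr0n.
have : \forall a \near \oo, forall c : 'I_(2 * m).+1, (0 < c)%N ->
    `|mu - S (c * 2 ^ a)%N / (c * 2 ^ a)%:R| <= e / 2.
  apply: filter_forall => c; have [c0|c0] := posnP c.
    by apply: nearW => a; rewrite c0.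
  by have /cvgrPdist_le/(_ _ e20) := Sc c c0; apply: filterS => a + _.
move=> [A _ HA].
exists (m * 2 ^ A)%N => // n /= hn.
(* The largest exponent with [m * 2 ^ a <= n]; it places [n %/ 2 ^ a] in [[m, 2 * m)]. *)
pose a := trunc_log 2 (n %/ m).
have m0' : (0 < m)%N by [].
have nm : (2 ^ A <= n %/ m)%N by rewrite leq_divRL// mulnC.
have nm0 : (0 < n %/ m)%N by rewrite (leq_trans _ nm)// expn_gt0.
have /andP[ha1 ha2] : (2 ^ a <= n %/ m < 2 ^ a.+1)%N.
  by apply: trunc_log_bounds.
have Aa : (A <= a)%N.
  by rewrite -ltnS -(@ltn_exp2l 2)//; exact: leq_ltn_trans nm ha2.
have b0 : (0 < 2 ^ a)%N by rewrite expn_gt0.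
pose c := (n %/ 2 ^ a)%N.
have hma : (m * 2 ^ a <= n)%N by rewrite mulnC -leq_divRL.
have hma2 : (n < m * 2 ^ a.+1)%N by rewrite mulnC -ltn_divLR.
have mc : (m <= c)%N by rewrite leq_divRL.
have c2m : (c < 2 * m)%N by rewrite ltn_divLR// -mulnA (mulnC m) mulnA -expnS mulnC.
have c0 : (0 < c)%N by exact: leq_trans mc.
have cn : (c * 2 ^ a <= n)%N by exact: leq_divM.
have nc : (n < c.+1 * 2 ^ a)%N by exact: ltn_ceil.
have n0 : (0 < n)%N by apply: leq_trans hma; rewrite muln_gt0 m0'.
have hc1 := HA a Aa (Ordinal (ltnW c2m : (c < (2 * m).+1)%N)) c0.
have hc2 := HA a Aa (Ordinal (c2m : (c.+1 < (2 * m).+1)%N)) isT.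
move: hc1 hc2 => /=.
have S1 := ndS _ _ cn; have S2 := ndS _ _ (ltnW nc).
have N0 : 0 < n%:R :> R by rewrite ltr0n.
have C0 : 0 < (c * 2 ^ a)%:R :> R by rewrite ltr0n muln_gt0 c0.
have C10 : 0 < (c.+1 * 2 ^ a)%:R :> R by rewrite ltr0n muln_gt0.
have CE : (c.+1 * 2 ^ a)%:R = (c * 2 ^ a)%:R + (2 ^ a)%:R :> R.
  by rewrite -natrD mulSn addnC.
have cnR : (c * 2 ^ a)%:R <= n%:R :> R by rewrite ler_nat.
have ncR : n%:R <= (c.+1 * 2 ^ a)%:R :> R by rewrite ler_nat ltnW.
have maR : m%:R * (2 ^ a)%:R <= n%:R :> R by rewrite -natrM ler_nat.
have BR : 0 < (2 ^ a)%:R :> R by rewrite ltr0n.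
rewrite !ler_distlC; move: S1 S2 N0 C0 C10 CE cnR ncR maR BR hm m0.
move: (S n) (S (c * 2 ^ a)%N) (S (c.+1 * 2 ^ a)%N) => sn s1 s2.
move: (n%:R : R) ((c * 2 ^ a)%:R : R) ((c.+1 * 2 ^ a)%:R : R) ((2 ^ a)%:R : R)
  (m%:R : R) => N C C1 B M.
move=> S1 S2 N0 C0 C10 CE cnR ncR maR BR hm m0.
rewrite ler_pdivlMr// ler_pdivrMr// => /andP[h1 _].
rewrite ler_pdivlMr// ler_pdivrMr// => /andP[_ h2].
rewrite ler_pdivlMr// ler_pdivrMr//.
have {}hm : 2 * (mu + e) <= M * e by rewrite -ler_pdivrMr.
(* The choice of [m] enters here: consecutive dyadic indices differ by [B <= N / M], so exchanging
   one of them for [N] costs at most [N * (e / 2)]. *)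
have hB : (mu + e) * B <= N * (e / 2).
  have : 2 * (mu + e) * B <= M * e * B by rewrite ler_pM2r.
  have : M * B * e <= N * e by rewrite ler_pM2r.
  nra.
apply/andP; split.
  have : (mu - e/2) * C <= sn by lra.
  have : mu * (N - B) <= mu * C.
    by apply: ler_wpM2l => //; move: ncR; rewrite CE; lra.
  have : e/2 * C <= e/2 * N by rewrite ler_pM2l.
  have : 0 <= e * B by rewrite mulr_ge0 ?ltW.
  nra.
have : sn <= (mu + e/2) * (C + B) by rewrite -CE; lra.
have : (mu + e/2) * C <= (mu + e/2) * N by rewrite ler_pM2l//; lra.
have : 0 <= e * B by rewrite mulr_ge0 ?ltW.
nra.
Qed.

(** * Pairwise independence and variance of sums *)

Definition independent_pair {d d'} {T : measurableType d} {T' : measurableType d'}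
    {R : realType} (P : probability T R) (X Y : {RV P >-> T'}) : Prop :=
  forall A B, measurable A -> measurable B ->
    P (X @^-1` A `&` Y @^-1` B) = (P (X @^-1` A) * P (Y @^-1` B))%E.

(** Covariances involve two variables at a time, and the property passes to [f \o X i], in
    particular to clipped variables and to positive and negative parts. *)
Definition pairwise_iid {d d'} {T : measurableType d} {T' : measurableType d'}
    {R : realType} (P : probability T R) (X : nat -> {RV P >-> T'}) : Prop :=
  (forall i j, i != j -> independent_pair (X i) (X j)) /\
  (forall i A, measurable A -> P (X i @^-1` A) = P (X 0%N @^-1` A)).

(** Values above [k] become [k] rather than 0. The event [k < X] then lies in [k <= clip k X], so
    that the second moment of the clipped variable also controls the tail. *)
Definition clip {R : realType} (k x : R) : R := Num.min x k.

Section clip.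
Context {R : realType} (k : R).

Let measurable_clip : measurable_fun [set: R] (clip k).
Proof. exact: measurable_minr. Qed.

HB.instance Definition _ :=
  isMeasurableFun.Build _ _ _ _ (clip k) measurable_clip.

Lemma clip_ge0 x : 0 <= k -> 0 <= x -> 0 <= clip k x.
Proof. by move=> k0 x0; rewrite le_min x0. Qed.

Lemma clip_le x : clip k x <= k.
Proof. by rewrite ge_min lexx orbT. Qed.

Lemma clip_id x : x <= k -> clip k x = x.
Proof. by move=> xk; rewrite /clip min_l. Qed.

Lemma clip_clamp x : k <= x -> clip k x = k.
Proof. by move=> xk; rewrite /clip min_r. Qed.

End clip.

Section independence.
Context {d} {T : measurableType d} {R : realType} (P : probability T R).

Lemma pairwise_iid_comp d1 d2 (T1 : measurableType d1) (T2 : measurableType d2)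
    (f : {mfun T1 >-> T2}) (X : nat -> {RV P >-> T1}) :
  pairwise_iid X -> pairwise_iid (fun i => f \o X i : {RV P >-> T2}).
Proof.
move=> [indX idX].
have mf (A : set T2) : measurable A -> measurable (f @^-1` A).
  by move=> mA; rewrite -[_ @^-1` _]setTI; exact: measurable_funP.
split=> [i j ij A B mA mB|i A mA].
  exact: (indX i j ij _ _ (mf A mA) (mf B mB)).
exact: (idX i _ (mf A mA)).
Qed.

(** The absolute value makes the integrand nonnegative on the whole line, as the change of variables
    for nonnegative functions requires. *)
Lemma ge0_expectation_distribution (X : {RV P >-> R}) : (forall x, 0 <= X x) ->
  ('E_P[X] = \int[distribution P X]_y `|y|%:E)%E.
Proof.
move=> X0; rewrite ge0_integral_distribution//; last first.
  by apply/measurable_EFinP; exact: normr_measurable.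
by rewrite unlock; apply: eq_integral => w _ /=; rewrite ger0_norm.
Qed.

Lemma expectation_eq_law (X Y : {RV P >-> R}) :
  (forall x, 0 <= X x) -> (forall x, 0 <= Y x) ->
  (forall A, measurable A -> P (X @^-1` A) = P (Y @^-1` A)) ->
  ('E_P[X] = 'E_P[Y])%E.
Proof.
move=> X0 Y0 XY.
rewrite !ge0_expectation_distribution//; apply: eq_measure_integral => A mA _; exact: XY.
Qed.

(** By independence the law of the pair agrees with the product of the laws on rectangles, hence
    everywhere; Tonelli's theorem then splits the integral of [|x| * |y|]. *)
Lemma expectation_mul_independent (X Y : {RV P >-> R}) :
  (forall x, 0 <= X x) -> (forall x, 0 <= Y x) -> independent_pair X Y ->
  ('E_P[(X : T -> R) * Y] = 'E_P[X] * 'E_P[Y])%E.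
Proof.
move=> X0 Y0 XY.
have mXY : measurable_fun setT (fun w => (X w, Y w)).
  exact: measurable_fun_pair.
pose XYm := isMeasurableFun.Build _ _ _ _ _ mXY.
pose XYf : {mfun T >-> (R * R)%type} := HB.pack (fun w => (X w, Y w)) XYm.
pose f (z : R * R) := (`|z.1| * `|z.2|)%:E.
have mf : measurable_fun setT f.
  apply/measurable_EFinP; apply: measurable_funM;
    by apply: measurableT_comp => //; exact: measurableT_comp.
have f0 z : (0 <= f z)%E by rewrite lee_fin mulr_ge0.
transitivity (\int[distribution P XYf]_z f z)%E.
  rewrite ge0_integral_distribution// unlock; apply: eq_integral => w _ /=.
  by rewrite /f/= !ger0_norm.
transitivity (\int[(distribution P X \x distribution P Y)%E]_z f z)%E.
  apply: eq_measure_integral => A mA _; apply/esym.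
  by apply: product_measure_unique => // B C mB mC; exact: XY.
rewrite fubini_tonelli1// !ge0_expectation_distribution// /fubini_F.
have mn : measurable_fun setT (fun y : R => `|y|%:E).
  by apply/measurable_EFinP; exact: normr_measurable.
rewrite -ge0_integralZr//; last by apply: integral_ge0 => y _; rewrite lee_fin.
by apply: eq_integral => x _; rewrite -ge0_integralZl.
Qed.

End independence.

Section variance.
Context {d} {T : measurableType d} {R : realType} (P : probability T R).

Lemma bounded_Lfun2 (f : {mfun T >-> R}) (M : R) :
  (forall x, `|f x| <= M) -> (f : T -> R) \in Lfun P 2%:E.
Proof.
move=> fM; rewrite inE/=; apply/andP; split; rewrite inE//=.
rewrite /finite_norm unlock poweR_lty//.
apply: (@le_lt_trans _ _ (\int[P]_x cst (M `^ 2)%:E x)%E).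
  apply: ge0_le_integral => //=.
  - apply/measurable_EFinP.
    apply: (measurableT_comp (measurable_powR _)) => //.
    exact: measurableT_comp.
  - move=> x _; rewrite lee_fin ge0_ler_powR// ?nnegrE//.
    exact: le_trans (fM x).
rewrite integral_cst//= probability_setT mule1 ltry//.
Qed.

Lemma variance_sum (Y : nat -> {RV P >-> R}) (n : nat) :
  (forall i, (Y i : T -> R) \in Lfun P 2%:E) ->
  (forall i j, i != j -> covariance P (Y i) (Y j) = 0%E) ->
  ('V_P[(\sum_(i < n) (Y i : T -> R))%R] = \sum_(i < n) 'V_P[Y i])%E.
Proof.
move=> Y2 Y0.
have S2 m : \sum_(i < m) (Y i : T -> R) \in Lfun P 2%:E.
  by rewrite rpred_sum ?lee1n.
(* Each partial sum is uncorrelated with every later variable, so variances add one step at a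
   time. *)
have Scov m j : (m <= j)%N ->
    covariance P (\sum_(i < m) (Y i : T -> R)) (Y j) = 0%E.
  elim: m => [|m IH] mj.
    by rewrite big_ord0 (covariance_cst_l P 0).
  by rewrite big_ord_recr/= covarianceDl ?S2// (IH (ltnW mj)) Y0 ?add0e// ltn_eqF.
elim: n => [|n IH]; first by rewrite !big_ord0 (variance_cst P 0).
by rewrite !big_ord_recr/= varianceD ?S2// IH Scov// mule0 adde0.
Qed.

Lemma variance_le_expectation_sqr (Y : {RV P >-> R}) :
  (Y : T -> R) \in Lfun P 2%:E -> ('V_P[Y] <= 'E_P[(Y : T -> R) ^+ 2])%E.
Proof.
move=> Y2; rewrite varianceE// leeBlDr; last first.
  rewrite fin_numX// expectation_fin_num// Lfun_subset12//.
  exact: fin_num_measure.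
rewrite leeDl// sqre_ge0//.
Qed.

Lemma covariance_independent (X Y : {RV P >-> R}) :
  (forall x, 0 <= X x) -> (forall x, 0 <= Y x) ->
  (X : T -> R) \in Lfun P 2%:E -> (Y : T -> R) \in Lfun P 2%:E ->
  independent_pair X Y -> covariance P X Y = 0%E.
Proof.
move=> X0 Y0 X2 Y2 XY.
have f1 (Z : T -> R) : Z \in Lfun P 2%:E -> Z \in Lfun P 1.
  by apply: Lfun_subset12; exact: fin_num_measure.
rewrite covarianceE ?(f1 _ X2) ?(f1 _ Y2)//; last exact: Lfun2_mul_Lfun1.
rewrite expectation_mul_independent// subee//.
by rewrite fin_numM// expectation_fin_num// f1.
Qed.

End variance.

(** * The strong law of large numbers *)

Section weak_law.
Context {d} {T : measurableType d} {R : realType} (P : probability T R).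
Variable X : nat -> {RV P >-> R}.
Hypothesis X0 : forall i w, 0 <= X i w.
Hypothesis iidX : pairwise_iid X.

Lemma measurable_deviation (k : nat) (e c : R) :
  measurable [set w | e <= `|(\sum_(i < k) X i w) / k%:R - c|].
Proof.
rewrite -[X in measurable X]setTI; apply: measurable_fun_le => //.
apply: measurableT_comp => //; apply: measurable_funB => //.
apply: measurable_funM => //; exact: measurable_sum.
Qed.

(* Off the event that some [X i] with [i < k] exceeds [k], the sum coincides with
   the sum of the clipped variables, to which Chebyshev's inequality applies. *)
Lemma probability_deviation_le (k : nat) (e : R) :
  (0 < k)%N -> 0 < e ->
  (P [set w | (e <= `|(\sum_(i < k) X i w) / k%:R -
                      fine 'E_P[clip k%:R \o X 0%N]|)%R] <=
   ((1 + e ^- 2) / k%:R)%:E * 'E_P[fun w => (clip k%:R (X 0%N w) ^+ 2)%R])%E.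
Proof.
move=> k0 e0.
pose Y i : {RV P >-> R} := clip k%:R \o X i.
have K0 : 0 < k%:R :> R by rewrite ltr0n.
have YE i w : Y i w = clip k%:R (X i w) by [].
have Y0 i w : 0 <= Y i w by rewrite clip_ge0// ltW.
have [indY idY] : pairwise_iid Y by exact: pairwise_iid_comp.
have Yk i w : Y i w <= k%:R by exact: clip_le.
have Y2 i : (Y i : T -> R) \in Lfun P 2%:E.
  by apply: (@bounded_Lfun2 _ _ _ _ _ k%:R) => w; rewrite ger0_norm.
have Y1 i : (Y i : T -> R) \in Lfun P 1.
  by apply: Lfun_subset12 (Y2 i); exact: fin_num_measure.
have EYi i : ('E_P[Y i] = 'E_P[Y 0%N])%E by exact: expectation_eq_law (idY i).
have Y1E : ('E_P[Y 0%N] = (fine 'E_P[Y 0%N])%:E)%E.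
  by rewrite fineK// expectation_fin_num.
set m := fine 'E_P[_]%E; have {}Y1E : ('E_P[Y 0%N] = m%:E)%E by [].
pose r := fine 'E_P[fun w => (Y 0%N w ^+ 2)%R]%E.
have rE : ('E_P[fun w => (clip k%:R (X 0%N w) ^+ 2)%R] = r%:E)%E.
  rewrite /r fineK// unlock; apply: integrable_fin_num => //.
  exact: Lfun2_integrable_sqr.
have r0 : 0 <= r.
  by rewrite -lee_fin -rE; apply: expectation_ge0 => w; exact: sqr_ge0.
pose S := \sum_(i < k) (Y i : T -> R).
have ES : ('E_P[S] = (k%:R * m)%:E)%E.
  have -> : S = \sum_(f <- [seq (Y i : T -> R) | i <- index_iota 0 k]) f.
    by rewrite big_map big_mkord.
  rewrite expectation_sum; last by move=> f /mapP[i _ ->].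
  rewrite big_map big_mkord.
  under eq_bigr do rewrite EYi Y1E.
  by rewrite sumEFin sumr_const card_ord mulr_natl.
have VS : ('V_P[S] <= (k%:R * r)%:E)%E.
  rewrite /S variance_sum//; last first.
    by move=> i j ij; apply: covariance_independent => //; exact: indY.
  rewrite mulr_natl -[k in leRHS]card_ord -sumr_const -sumEFin.
  apply: lee_sum => i _; apply: (le_trans (variance_le_expectation_sqr (Y2 i))).
  rewrite -rE le_eqVlt; apply/orP; left; apply/eqP.
  pose sq (x : R) := x ^+ 2.
  have msq : measurable_fun [set: R] sq by exact: measurable_funX.
  pose sqm : {mfun R >-> R} := HB.pack sq (isMeasurableFun.Build _ _ _ _ _ msq).
  apply: (@expectation_eq_law _ _ _ P (sqm \o Y i) (sqm \o Y 0%N)).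
  - by move=> w; exact: sqr_ge0.
  - by move=> w; exact: sqr_ge0.
  - by apply: (pairwise_iid_comp sqm _).2; split.
(* Markov's inequality for the square of [Y 0], which equals [k] wherever [X 0] exceeds [k]. *)
have Ptail i : (P [set w | (k%:R < X i w)%R] <= (r / k%:R ^+ 2)%:E)%E.
  have -> : P [set w | (k%:R < X i w)%R] = P (X i @^-1` `]k%:R, +oo[).
    by congr (P _); apply/seteqP; split => w /=; rewrite in_itv/= andbT.
  rewrite iidX.2//.
  have := @markov _ _ _ P (Y 0%N) (fun x => x ^+ 2) _ K0 _ _ _.
  have -> : ('E_P[(fun x => (x ^+ 2)%R) \o (fun x => `|x|%R) \o Y 0%N] = r%:E)%E.
    rewrite -rE; apply: (congr1 (expectation P)); apply/funext => w.
    by rewrite /= (ger0_norm (Y0 0%N w)).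
  move=> M; rewrite -(@lee_pmul2l _ (k%:R ^+ 2)%:E)//; last first.
    by rewrite lte_fin exprn_gt0.
  rewrite -EFinM mulrCA divff ?mulr1 ?expf_neq0 ?gt_eqF//.
  apply: le_trans (M _ _ _).
  - apply: lee_wpmul2l; first by rewrite lee_fin exprn_ge0.
    apply: le_measure; rewrite ?inE.
    + by rewrite -[X in measurable X]setTI; exact: measurable_funP.
    + rewrite -[X in measurable X]setTI; apply: measurable_lee => //.
      by apply/measurable_EFinP; exact: measurableT_comp.
    + move=> w /=; rewrite in_itv/= andbT => /ltW kX.
      by rewrite (ger0_norm (Y0 0%N w)) lee_fin YE clip_clamp.
  - exact: measurable_funX.
  - by move=> x _; exact: sqr_ge0.
  - by move=> x y; rewrite !nnegrE => x0 y0; rewrite ler_sqr.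
pose A i := [set w | k%:R < X i w].
have mA i : measurable (A i).
  have -> : A i = X i @^-1` `]k%:R, +oo[.
    by apply/seteqP; split => w /=; rewrite in_itv/= andbT.
  by rewrite -[X in measurable X]setTI; exact: measurable_funP.
pose B := [set w | e * k%:R <= `|S w - fine 'E_P[S]%E|].
have S2 : S \in Lfun P 2%:E by rewrite /S rpred_sum ?lee1n.
have mS : measurable_fun setT S by have := sub_Lfun_mfun S2; rewrite inE.
have mB : measurable B.
  rewrite -[X in measurable X]setTI; apply: measurable_fun_le => //.
  by apply: measurableT_comp => //; exact: measurable_funB.
(* Chebyshev at distance [e * k]: the variance is at most [k * r], and
   [k * r / (e * k) ^ 2 = r / (e ^ 2 * k)]. *)
have PB : (P B <= (r / (e ^+ 2 * k%:R))%:E)%E.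
  pose Sm : {RV P >-> R} := HB.pack S (isMeasurableFun.Build _ _ _ _ _ mS).
  have := @chebyshev _ _ _ P Sm (e * k%:R) (mulr_gt0 e0 K0).
  move/le_trans; apply.
  apply: (@le_trans _ _ (((e * k%:R) ^- 2)%:E * (k%:R * r)%:E)%E).
    by apply: lee_wpmul2l => //; rewrite lee_fin invr_ge0 exprn_ge0// mulr_ge0 ?ltW.
  rewrite -EFinM lee_fin le_eqVlt; apply/orP; left; apply/eqP.
  by field; rewrite !gt_eqF.
apply: (@le_trans _ _ (P (\big[setU/set0]_(i < k) A i `|` B))).
  apply: le_measure; rewrite ?inE.
  - exact: measurable_deviation.
  - by apply: measurableU => //; exact: bigsetU_measurable.
  - move=> w /= h; have [hA|hA] := pselect (exists2 i, (i < k)%N & A i w).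
      by left; rewrite -bigcup_mkord; case: hA => i ik Ai; exists i.
    right; rewrite /B/= ES/=.
    have -> : S w = \sum_(i < k) X i w.
      rewrite /S fct_sumE; apply: eq_bigr => i _; rewrite YE clip_id//.
      by rewrite leNgt; apply/negP => kX; apply: hA; exists i.
    move: h; rewrite -(ler_pM2r K0) => /le_trans; apply.
    rewrite -[X in _ * X](ger0_norm (ltW K0)) -normrM.
    by rewrite mulrBl divfK ?gt_eqF// [m * _]mulrC.
apply: (le_trans (measureU2 _ _ _)) => //; first exact: bigsetU_measurable.
(* The [k] tails contribute [k * (r / k ^ 2)], which gives the 1 in [1 + e ^- 2]; Chebyshev's bound
   gives the other summand. *)
apply: (@le_trans _ _ ((k%:R * (r / k%:R ^+ 2))%:E + (r / (e ^+ 2 * k%:R))%:E)%E).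
  apply: leeD => //; apply: (le_trans (Boole_inequality _ _)) => //.
  rewrite mulr_natl -[X in (_ *+ X)%:E]card_ord -sumr_const -sumEFin.
  by apply: lee_sum => i _; exact: Ptail.
rewrite rE -EFinD -EFinM lee_fin le_eqVlt; apply/orP; left; apply/eqP.
by field; rewrite !gt_eqF.
Qed.

End weak_law.

(** * Almost sure convergence for nonnegative variables *)

Section strong_law.
Context {d} {T : measurableType d} {R : realType} (P : probability T R).
Variable X : nat -> {RV P >-> R}.
Hypothesis X0 : forall i w, 0 <= X i w.
Hypothesis iidX : pairwise_iid X.
Hypothesis EX : ('E_P[X 0%N] < +oo)%E.

Let EX_fin : 'E_P[X 0%N]%E \is a fin_num.
Proof. by rewrite ge0_fin_numE// expectation_ge0. Qed.

(** Dominated convergence with dominating function [X 0]: at each [w] the clipped values are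
    constant once [k] exceeds [X 0 w]. *)
Lemma cvg_expectation_clip :
  fine 'E_P[clip k%:R \o X 0%N]%E @[k --> \oo] --> fine 'E_P[X 0%N]%E.
Proof.
apply: fine_cvg; rewrite fineK//.
have iX : P.-integrable setT (EFin \o X 0%N).
  apply/integrableP; split; first exact/measurable_EFinP.
  by move: EX; rewrite unlock; under eq_integral do rewrite -[_%:E]gee0_abs ?lee_fin//.
rewrite unlock.
have [] := @dominated_convergence _ _ _ P setT measurableT
  (fun k w => (clip k%:R (X 0%N w))%:E) (EFin \o X 0%N) (EFin \o X 0%N) => //.
- by move=> k; apply/measurable_EFinP; exact: measurableT_comp.
- exact/measurable_EFinP.
- apply: aeW => w _; apply: cvg_near_cst.
  exists (Num.truncn (X 0%N w)).+1 => // k /= hk.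
  rewrite clip_id//; apply/ltW; apply: lt_le_trans (truncnS_gt _) _.
  by rewrite ler_nat.
- apply: aeW => w k _; rewrite lee_fin ger0_norm ?clip_ge0//.
  by rewrite ge_min lexx.
Qed.

(** After exchanging the finite sums with the expectation, [sum_clip_sqr_le] applies pointwise and
    bounds every partial sum by [(1 + e ^- 2) * 3 * E[X 0]]. *)
Lemma sum_probability_deviation_lty (c : nat) (e : R) : (0 < c)%N -> 0 < e ->
  (\sum_(a <oo) P [set w | (e <= `|(\sum_(i < c * 2 ^ a) X i w) / (c * 2 ^ a)%:R
      - fine 'E_P[clip (c * 2 ^ a)%:R \o X 0%N]|)%R] < +oo)%E.
Proof.
move=> c0 e0.
have C0 : 0 <= 1 + e ^- 2 by rewrite addr_ge0// invr_ge0 exprn_ge0// ltW.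
have k0 a : (0 < c * 2 ^ a)%N by rewrite muln_gt0 c0 expn_gt0.
have mX : measurable_fun setT (fun w => (3 * X 0%N w)%:E).
  by apply/measurable_EFinP; exact: measurable_funM.
have mclip k : measurable_fun setT (fun w => (clip k (X 0%N w) ^+ 2)%:E).
  by apply/measurable_EFinP; apply: measurable_funX; exact: measurableT_comp.
apply: (@le_lt_trans _ _ ((1 + e ^- 2)%:E * (3%:E * 'E_P[X 0%N]))%E); last first.
  by rewrite -(fineK EX_fin) -!EFinM ltry.
apply: lime_le; first exact: is_cvg_nneseries.
apply: nearW => n; rewrite big_mkord.
apply: (@le_trans _ _ (\sum_(a < n) (1 + e ^- 2)%:E *
    ((c * 2 ^ a)%:R^-1%:E * 'E_P[fun w => (clip (c * 2 ^ a)%:R (X 0%N w) ^+ 2)%R]))%E).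
  by apply: lee_sum => a _; rewrite muleA -EFinM; exact: probability_deviation_le.
rewrite -ge0_sume_distrr; last first.
  move=> a _; apply: mule_ge0; first by rewrite lee_fin invr_ge0.
  by apply: expectation_ge0 => w; exact: sqr_ge0.
apply: lee_wpmul2l; first by rewrite lee_fin.
have intE (a : nat) : ((c * 2 ^ a)%:R^-1%:E *
    'E_P[fun w => (clip (c * 2 ^ a)%:R (X 0%N w) ^+ 2)%R] =
    \int[P]_w ((c * 2 ^ a)%:R^-1%:E * (clip (c * 2 ^ a)%:R (X 0%N w) ^+ 2)%:E))%E.
  rewrite unlock ge0_integralZl//.
  by move=> w _; rewrite lee_fin sqr_ge0.
have -> : (3%:E * 'E_P[X 0%N] = \int[P]_w (3%:E * (X 0%N w)%:E))%E.
  rewrite unlock ge0_integralZl//; first exact/measurable_EFinP.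
  by move=> w _; rewrite lee_fin.
rewrite [leLHS](_ : _ = \int[P]_w \sum_(a < n)
    ((c * 2 ^ a)%:R^-1%:E * (clip (c * 2 ^ a)%:R (X 0%N w) ^+ 2)%:E))%E; last first.
  rewrite ge0_integral_sum//; first by apply: eq_bigr => a _; exact: intE.
    by move=> a; exact: measurable_funeM.
  by move=> a w _; rewrite -EFinM lee_fin mulr_ge0 ?invr_ge0 ?sqr_ge0.
apply: ge0_le_integral => //.
- move=> w _; apply: sume_ge0 => a _.
  by rewrite -EFinM lee_fin mulr_ge0 ?invr_ge0 ?sqr_ge0.
- by apply: emeasurable_sum => a; exact: measurable_funeM.
- move=> w _; under eq_bigr do rewrite -EFinM.
  rewrite sumEFin lee_fin.
  under eq_bigr do rewrite mulrC natrM natrX.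
  by apply: sum_clip_sqr_le => //; rewrite ltr0n.
Qed.

Lemma strong_law_dyadic (c : nat) : (0 < c)%N ->
  {ae P, forall w, (\sum_(i < c * 2 ^ a) X i w) / (c * 2 ^ a)%:R @[a --> \oo]
     --> fine 'E_P[X 0%N]%E}.
Proof.
move=> c0.
pose m a := fine 'E_P[clip (c * 2 ^ a)%:R \o X 0%N]%E.
pose avg a w : R := (\sum_(i < c * 2 ^ a) X i w) / (c * 2 ^ a)%:R.
have mcvg : m a @[a --> \oo] --> fine 'E_P[X 0%N]%E.
  apply: (cvg_comp (fun a => (c * 2 ^ a)%N) _ _ cvg_expectation_clip).
  move=> A [N _ NA]; exists N => // a /= Na; apply: NA => /=.
  by rewrite (leq_trans Na)// (leq_trans (ltnW (ltn_expl a (ltnSn 1))))// leq_pmull.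
(* The radii [1 / (j + 1)] are countably many, so their exceptional sets still form a null set. The
   centres [m a] move with [a] and tend to the mean. *)
have : \forall w \ae P, forall j, \forall a \near \oo, `|avg a w - m a| < j.+1%:R^-1.
  apply: ae_foralln => j; have e0 : 0 < j.+1%:R^-1 :> R by rewrite invr_gt0.
  pose F a := [set w | j.+1%:R^-1 <= `|avg a w - m a|].
  have mF a : measurable (F a) by exact: measurable_deviation.
  (* Borel-Cantelli: the points lying in infinitely many [F a] form a null set. *)
  exists (lim_sup_set F); split.
  - by apply: bigcap_measurable => // n _; exact: bigcup_measurable.
  - by apply: lim_sup_set_cvg0 => //; exact: sum_probability_deviation_lty.
  - move=> w /= nw n _; apply/not_exists2P => h; apply: nw.
    exists n => // a /= na; rewrite ltNge; apply/negP => Fa.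
    by have [] := h a.
apply: filterS => w hw; apply/cvgrPdist_lt => /= e e0.
have e20 : 0 < e / 2 by rewrite divr_gt0.
have [j hj] : exists j, j.+1%:R^-1 <= e / 2.
  exists (Num.truncn (e / 2)^-1); rewrite invf_ple ?posrE//.
  by apply/ltW; exact: truncnS_gt.
have := hw j; have /cvgrPdist_lt/(_ _ e20) := mcvg; apply: filterS2 => a h1 h2.
rewrite [ltRHS]splitr -(subrKA (m a)) (le_lt_trans (ler_normD _ _))//.
by rewrite ltrD// distrC (lt_le_trans h2).
Qed.

Theorem strong_law_ge0 :
  {ae P, forall w, (\sum_(i < n) X i w) / n%:R @[n --> \oo]
     --> fine 'E_P[X 0%N]%E}.
Proof.
(* One null set serves all [c]; writing [c.+1] builds in positivity. *)
have : \forall w \ae P, forall c,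
    (\sum_(i < c.+1 * 2 ^ a) X i w) / (c.+1 * 2 ^ a)%:R @[a --> \oo]
     --> fine 'E_P[X 0%N]%E.
  by apply: ae_foralln => c; exact: strong_law_dyadic.
apply: filterS => w h.
apply: (@cvg_dyadic_average _ (fun n => \sum_(i < n) X i w)).
- by apply/nondecreasing_seqP => n; rewrite big_ord_recr/= lerDl.
- by apply: fine_ge0; exact: expectation_ge0.
- by move=> [//|c] _; exact: h.
Qed.

End strong_law.

(** * Integrable real variables, by positive and negative parts *)

Section strong_law_real.
Context {d} {T : measurableType d} {R : realType} (P : probability T R).

Let pos (x : R) : R := Num.max x 0.
Let neg (x : R) : R := Num.max (- x) 0.

Let mpos : measurable_fun [set: R] pos.
Proof. exact: measurable_maxr. Qed.

Let mneg : measurable_fun [set: R] neg.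
Proof. by apply: measurable_maxr => //; exact: measurableT_comp. Qed.

Let posm : {mfun R >-> R} := HB.pack pos (isMeasurableFun.Build _ _ _ _ _ mpos).
Let negm : {mfun R >-> R} := HB.pack neg (isMeasurableFun.Build _ _ _ _ _ mneg).

Let pos_neg x : x = pos x - neg x.
Proof. by rewrite /pos /neg !maxEle; do 2 case: ifPn; rewrite -?ltNge; lra. Qed.

Theorem strong_law (X : nat -> {RV P >-> R}) :
  pairwise_iid X -> P.-integrable setT (EFin \o X 0%N) ->
  {ae P, forall w, (\sum_(i < n) X i w) / n%:R @[n --> \oo]
     --> fine 'E_P[X 0%N]%E}.
Proof.
move=> iidX iX.
(* Both parts are measurable functions between 0 and the absolute value, so one argument covers
   them. *)
have part (f : {mfun R >-> R}) : (forall x, 0 <= f x <= `|x|) ->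
    (f \o X 0%N : T -> R) \in Lfun P 1 /\
    {ae P, forall w, (\sum_(i < n) f (X i w)) / n%:R @[n --> \oo]
      --> fine 'E_P[f \o X 0%N]%E}.
  move=> hf; have fL : (f \o X 0%N : T -> R) \in Lfun P 1.
    apply/Lfun1_integrable; apply: le_integrable iX => //.
      by apply/measurable_EFinP; exact: measurableT_comp.
    move=> w _ /=; have /andP[f0 fX] := hf (X 0%N w).
    by rewrite lee_fin ger0_norm.
  split => //; apply: (@strong_law_ge0 _ _ _ P (fun i => f \o X i)).
  - by move=> i w; have /andP[] := hf (X i w).
  - exact: pairwise_iid_comp.
  - rewrite -ge0_fin_numE; first exact: expectation_fin_num.
    by apply: expectation_ge0 => w; have /andP[] := hf (X 0%N w).
have [|pL hp] := part posm.
  by move=> x; rewrite /= /pos le_max lexx orbT ge_max ler_norm normr_ge0.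
have [|nL hn] := part negm.
  by move=> x; rewrite /= /neg le_max lexx orbT ge_max -normrN ler_norm normr_ge0.
have EX : fine 'E_P[X 0%N]%E =
    fine 'E_P[posm \o X 0%N]%E - fine 'E_P[negm \o X 0%N]%E.
  rewrite -fineB ?expectation_fin_num// -expectationB//.
  by congr (fine (expectation P _)); apply/funext => w; exact: pos_neg.
apply: filterS2 hp hn => w hp hn; rewrite EX.
rewrite (_ : (fun n : nat => _) = (fun n : nat =>
   (\sum_(i < n) pos (X i w)) / n%:R - (\sum_(i < n) neg (X i w)) / n%:R)).
  exact: cvgB.
apply/funext => n; rewrite -mulrBl -sumrB; congr (_ / _).
by apply: eq_bigr => i _; exact: pos_neg.
Qed.

End strong_law_real.

(** * Random vectors, coordinate by coordinate *)

Section strong_law_vectors.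
Context {d} {T : measurableType d} {R : realType} {m : nat} (P : probability T R).

Lemma continuous_borel_measurable (f : 'rV[R]_m -> R) : continuous f ->
  measurable_fun [set: borel_rV R m] f.
Proof.
move=> /continuousP cf.
apply: (measurability _ (RGenOpens.measurableE R)).
move=> _ [_ [a [b ->] <-]]; rewrite setTI.
by apply: sub_sigma_algebra; apply: cf; exact: interval_open.
Qed.

Lemma measurable_coord (i : 'I_m) :
  measurable_fun [set: borel_rV R m] (fun x : 'rV[R]_m => x ord0 i).
Proof. by apply: continuous_borel_measurable => x; exact: coord_continuous. Qed.

Lemma measurable_enorm :
  measurable_fun [set: borel_rV R m] (@enorm R m).
Proof.
have msqrt := continuous_measurable_fun (@sqrt_continuous R).
apply: (measurableT_comp (T1 := borel_rV R m) msqrt).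
by apply: measurable_sum => i; apply: measurable_funX; exact: measurable_coord.
Qed.

Lemma iid_pairwise_iid (Z : nat -> {RV P >-> borel_rV R m}) :
  iid Z -> pairwise_iid Z.
Proof.
move=> [indZ idZ]; split=> [i j ij A B mA mB|i A mA]; last exact: idZ.
(* Mutual independence on the index set [{i, j}], for the family equal to [A] at [i] and to [B] at
   every other index. *)
have /= := indZ [fset i; j]%fset (fun l => if l == i then A else B) _.
have -> : \bigcap_(l in [set` [fset i; j]%fset])
    Z l @^-1` (if l == i then A else B) = Z i @^-1` A `&` Z j @^-1` B.
  apply/seteqP; split => [w h|w [Aw Bw] l /=].
    split; first by have := h i; rewrite eqxx; apply; rewrite /= !inE eqxx.
    have := h j; rewrite eq_sym (negPf ij); apply.
    by rewrite /= !inE eqxx orbT.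
  by rewrite !inE => /orP[/eqP ->|/eqP ->]; rewrite ?eqxx// eq_sym (negPf ij).
rewrite big_fsetU1/= ?inE// big_seq_fset1 eqxx eq_sym (negPf ij).
by apply=> l; case: ifP.
Qed.

(** Coordinates are dominated by [enorm], hence integrable; conversely [enorm] is at most [sqrt m]
    times the sup norm, so convergence of the finitely many coordinates suffices. *)
Theorem strong_law_rV (Z : nat -> {RV P >-> borel_rV R m}) :
  iid Z -> ('E_P[fun w => enorm (Z 0%N w)] < +oo)%E ->
  {ae P, forall w,
    enorm (n%:R^-1 *: walk Z n w - mean_vector P (Z 0%N)) @[n --> \oo] --> 0}.
Proof.
move=> iidZ EZ.
have mE : measurable_fun setT (fun w => enorm (Z 0%N w)).
  by apply: measurableT_comp => //; exact: measurable_enorm.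
have iE : P.-integrable setT (fun w => (enorm (Z 0%N w))%:E).
  apply/integrableP; split; first exact/measurable_EFinP.
  apply: le_lt_trans EZ; rewrite unlock le_eqVlt; apply/orP; left; apply/eqP.
  by apply: eq_integral => w _; rewrite gee0_abs// lee_fin enorm_ge0.
have coord (i : 'I_m) : {ae P, forall w,
    (\sum_(j < n) Z j w ord0 i) / n%:R @[n --> \oo] -->
      mean_vector P (Z 0%N) ord0 i}.
  rewrite mxE.
  pose c : {mfun borel_rV R m >-> R} :=
    HB.pack (fun x : 'rV[R]_m => x ord0 i)
      (isMeasurableFun.Build _ _ _ _ _ (measurable_coord i)).
  apply: (@strong_law _ _ _ P (fun j => c \o Z j)).
    by apply: pairwise_iid_comp; exact: iid_pairwise_iid.
  apply: le_integrable iE => //.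
    by apply/measurable_EFinP; exact: measurableT_comp.
  move=> w _ /=; rewrite lee_fin [leRHS]ger0_norm ?enorm_ge0//.
  exact: enorm_coord.
have : \forall w \ae P, forall i : 'I_m,
    (\sum_(j < n) Z j w ord0 i) / n%:R @[n --> \oo] -->
      mean_vector P (Z 0%N) ord0 i by exact: filter_forall.
apply: filterS => w h; apply/cvgrPdist_le => /= e e0.
(* The added 1 keeps the divisor positive when [m = 0]. *)
pose q : R := Num.sqrt m%:R + 1.
have q0 : 0 < q by rewrite ltr_pwDr// sqrtr_ge0.
have d0 : 0 < e / q by rewrite divr_gt0.
have : \forall n \near \oo, forall i : 'I_m,
    `|mean_vector P (Z 0%N) ord0 i - (\sum_(j < n) Z j w ord0 i) / n%:R| <= e / q.
  by apply: filter_forall => i; have /cvgrPdist_le := h i; exact.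
apply: filterS => n hn; rewrite sub0r normrN ger0_norm ?enorm_ge0//.
rewrite (le_trans (enorm_le_normr _))//.
have {}hn : `|n%:R^-1 *: walk Z n w - mean_vector P (Z 0%N)| <= e / q.
  rewrite /Num.norm/= mx_normrE; apply/bigmax_leP; split; first exact: ltW.
  move=> [k i] _ /=; rewrite (ord1 k); have := hn i; rewrite distrC.
  suff -> : (n%:R^-1 *: walk Z n w - mean_vector P (Z 0%N)) ord0 i =
    (\sum_(j < n) Z j w ord0 i) / n%:R - mean_vector P (Z 0%N) ord0 i by [].
  by rewrite [LHS]mxE [X in X + _]mxE [X in _ + X]mxE /walk summxE mulrC.
apply: (@le_trans _ _ (Num.sqrt m%:R * (e / q))).
  by rewrite ler_wpM2l// sqrtr_ge0.
rewrite mulrA ler_pdivrMr// mulrC ler_pM2l// lerDl//.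
Qed.

End strong_law_vectors.
(** * Convergence of the hulls *)

(** A closed thickening given by an explicit witness instead of the infimum [rho], so that convexity
    follows by combining witnesses. *)
Definition nearby {R : realType} {m : nat} (K : set 'rV[R]_m) (e : R) :
    set 'rV[R]_m :=
  [set x | exists2 y, K y & enorm (x - y) <= e].

Section hulls_of_walks.
Context {R : realType} {m : nat}.

Lemma enormZ (c : R) (x : 'rV[R]_m) : enorm (c *: x) = `|c| * enorm x.
Proof.
rewrite /enorm -sqrtr_sqr -sqrtrM ?sqr_ge0// mulr_sumr.
by congr Num.sqrt; apply: eq_bigr => i _; rewrite mxE exprMn.
Qed.

(** The scaling sits inside the preimage so that minimality of [chull] applies to the unscaled
    points of the walks. *)
Lemma convex_preimage_nearby (K : set 'rV[R]_m) (c e : R) :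
  convex_set (K : set (convex_lmodType _)) ->
  convex_set ([set x | nearby K e (c *: x)] : set (convex_lmodType _)).
Proof.
move=> /convex_setP cK; apply/convex_setP => x y t t0 t1 [x' Kx xe] [y' Ky ye].
exists (t *: x' + (1 - t) *: y'); first exact: cK.
have -> : c *: (t *: x + (1 - t) *: y) - (t *: x' + (1 - t) *: y') =
    t *: (c *: x - x') + (1 - t) *: (c *: y - y').
  by rewrite !scalerDr !scalerN !scalerA ![c * _]mulrC opprD addrACA.
rewrite (le_trans (ler_enormD _ _))// !enormZ !ger0_norm ?subr_ge0//.
have : t * enorm (c *: x - x') <= t * e by rewrite ler_wpM2l.
have : (1 - t) * enorm (c *: y - y') <= (1 - t) * e by rewrite ler_wpM2l// subr_ge0.
lra.
Qed.

Lemma rho_nearby (K : convex_body R m) (x : 'rV[R]_m) (e : R) :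
  nearby K e x -> rho x K <= e.
Proof. by move=> [y Ky xy]; exact: le_trans (rho_le x Ky) xy. Qed.

(** For [j >= N] the deviation of [S j] from [j *: mu] is at most [j * e <= n * e]; the finitely
    many earlier ones are bounded by a constant, which [n * e] eventually exceeds. *)
Lemma walk_uniform_approx (S : nat -> 'rV[R]_m) (mu : 'rV[R]_m) (e : R) :
  0 < e -> S 0%N = 0 ->
  enorm (n%:R^-1 *: S n - mu) @[n --> \oo] --> 0 ->
  \forall n \near \oo, forall j, (j <= n)%N ->
    enorm (n%:R^-1 *: S j - (j%:R / n%:R) *: mu) <= e.
Proof.
move=> e0 S0 /cvgrPdist_le/(_ _ e0)[N _ HN].
pose M := \sum_(j < N) enorm (S j - j%:R *: mu).
exists (maxn N (Num.truncn (M / e)).+1) => // n /=; rewrite geq_max => /andP[Nn Mn] j jn.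
have n0 : (0 < n)%N by exact: leq_trans Mn.
have N0 : 0 < n%:R :> R by rewrite ltr0n.
have hM : M <= e * n%:R.
  rewrite mulrC -ler_pdivrMr//; apply: ltW; apply: lt_le_trans (truncnS_gt _) _.
  by rewrite ler_nat.
have -> : n%:R^-1 *: S j - (j%:R / n%:R) *: mu = n%:R^-1 *: (S j - j%:R *: mu).
  by rewrite scalerBr scalerA [_^-1 * _]mulrC.
rewrite enormZ ger0_norm ?invr_ge0// mulrC ler_pdivrMr//.
have [jN|Nj] := ltnP j N.
  apply: le_trans hM; rewrite /M (bigD1 (Ordinal jN))//= lerDl.
  by apply: sumr_ge0 => i _; exact: enorm_ge0.
(* If [N = 0], the index 0 falls in this range, and there [j%:R^-1] is 0 and cannot be cancelled. *)
have [->|j0] := posnP j; first by rewrite S0 scale0r subrr enorm0 mulr_ge0 ?ltW.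
have J0 : 0 < j%:R :> R by rewrite ltr0n.
have := HN j Nj; rewrite /= sub0r normrN ger0_norm ?enorm_ge0// => h.
have -> : S j - j%:R *: mu = j%:R *: (j%:R^-1 *: S j - mu).
  by rewrite scalerBr scalerA divff ?gt_eqF// scale1r.
rewrite enormZ ger0_norm// mulrC ler_pM ?enorm_ge0// ler_nat//.
Qed.

Lemma cvg_hull_of_walks (T : Type) (X : 'I_2 -> nat -> T -> 'rV[R]_m)
    (mu : 'I_2 -> 'rV[R]_m) (w : T) :
  (forall k, enorm (n%:R^-1 *: walk (X k) n w - mu k) @[n --> \oo] --> 0) ->
  scale_body n%:R^-1
    (chull_body (walk_points X n w) (walk_points_finite X n w)
       (walk_points_neq0 X n w)) @[n --> \oo] -->
  chull_body [set 0; mu ord0; mu ord_max]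
    (set3_finite 0 (mu ord0) (mu ord_max))
    (set3_neq0 0 (mu ord0) (mu ord_max)).
Proof.
move=> h; apply/cvg_ballP => e e0.
(* Half of [e] turns the non-strict bound on the Hausdorff distance into membership in the open
   ball. *)
have e20 : 0 < e / 2 by rewrite divr_gt0.
have : \forall n \near \oo, forall k j, (j <= n)%N ->
    enorm (n%:R^-1 *: walk (X k) j w - (j%:R / n%:R) *: mu k) <= e / 2.
  apply: filter_forall => k; apply: walk_uniform_approx => //.
  by rewrite /walk big_ord0.
have : \forall n \near \oo, (0 < n)%N by exists 1%N.
apply: filterS2 => n n0 hn.
set K := chull_body [set 0; _; _] _ _; set H := scale_body _ _.
have N0 : 0 < n%:R :> R by rewrite ltr0n.
have K0 : body_set K 0 by apply: sub_chull; left; left.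
have Kmu k : body_set K (mu k).
  apply: sub_chull; have [->|->] : k = ord0 \/ k = ord_max.
    by case: k => [[|[|//]] i]; [left|right]; exact: val_inj.
    by left; right.
  by right.
rewrite ballEmdist/= mdist_convex_bodyE.
apply: (@le_lt_trans _ _ (e / 2)); last by rewrite ltr_pdivrMr// ltr_pMr// ltr1n.
apply: hausdorff_dist_le => x.
  (* The factor 1 is inserted so that the same convexity lemma serves this inclusion; only the three
     vertices remain to be checked. *)
  move=> Kx; apply: rho_nearby; rewrite -[x]scale1r.
  suff : body_set K `<=` [set x | nearby H (e / 2) (1 *: x)] by exact.
  apply: smallest_sub.
    by apply: convex_preimage_nearby; exact: body_convex.
  have Hw k j : (j <= n)%N -> body_set H (n%:R^-1 *: walk (X k) j w).
    by move=> jn; exists (walk (X k) j w) => //; apply: sub_chull; exists j, k.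
  have muH k : nearby H (e / 2) (1 *: mu k).
    exists (n%:R^-1 *: walk (X k) n w); first exact: Hw.
    by rewrite enorm_distC; have := hn k n (leqnn n); rewrite divff ?gt_eqF.
  move=> y [[->|->]|->]; [|exact: muH..].
  (* The vertex 0 is matched by the common starting point of the walks. *)
  exists (n%:R^-1 *: walk (X ord0) 0 w); first exact: Hw.
  by rewrite /walk big_ord0 !scaler0 subrr enorm0 ltW.
move=> [y Ky <-]; apply: rho_nearby.
suff : chull (walk_points X n w) `<=` [set x | nearby K (e / 2) (n%:R^-1 *: x)].
  by apply.
apply: smallest_sub; first by apply: convex_preimage_nearby; exact: body_convex.
move=> _ [j [k [jn ->]]]; exists ((j%:R / n%:R) *: mu k); last exact: hn.
(* The approximating point [(j / n) *: mu k] lies on the segment from 0 to [mu k], because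
   [j <= n]. *)
have /convex_setP cK := @body_convex _ _ K.
have := cK (mu k) 0 (j%:R / n%:R) _ _ (Kmu k) K0.
rewrite scaler0 addr0; apply; first by rewrite divr_ge0.
by rewrite ler_pdivrMr// mul1r ler_nat.
Qed.

End hulls_of_walks.

Theorem theorem2p1 (R : realType) (d : measure_display) (T : measurableType d)
    (P : probability T R) (Z : 'I_2 -> nat -> {RV P >-> borel_rV R 2})
    (mu : 'I_2 -> 'rV[R]_2)
    (Z_iid : forall k, iid (Z k))
    (Z_indep : independent_sequences (Z ord0) (Z ord_max))
    (Z_int : forall k, ('E_P[fun w => enorm (Z k 0%N w)] < +oo)%E)
    (Z_mean : forall k, mu k = mean_vector P (Z k 0%N)) :
  {ae P, forall w,
    scale_body n%:R^-1
      (chull_body (walk_points Z n w) (walk_points_finite Z n w)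
         (walk_points_neq0 Z n w)) @[n --> \oo] -->
    chull_body [set 0; mu ord0; mu ord_max]
      (set3_finite 0 (mu ord0) (mu ord_max))
      (set3_neq0 0 (mu ord0) (mu ord_max))}.
Proof.
have : \forall w \ae P, forall k,
    enorm (n%:R^-1 *: walk (Z k) n w - mu k) @[n --> \oo] --> 0.
  by apply: filter_forall => k; rewrite Z_mean; exact: strong_law_rV.
by apply: filterS => w; exact: cvg_hull_of_walks.
Qed.
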